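(* For every $n\ge 3$ and every fixed convex body $K\subset\mathbf{R}^2$, the convex geometry $(U_n,\tau_n)$ is not representable by $\mathcal{H}(K)=\{t+\lambda K: t\in\mathbf{R}^2,\ \lambda\in\mathbf{R}_{>0}\}$.
   Context: $\mathrm{Conv}$ denotes the convex hull, and $\subset$ means not necessarily strict inclusion. A convex body is a compact convex set with nonempty interior. A convex geometry is a pair $(U,\tau)$ where $U$ is a set and $\tau:2^U\to 2^U$ is a closure operator with $\tau(\varnothing)=\varnothing$ satisfying the anti-exchange axiom: for all $x,y\in U$ with $x\ne y$ and all $A\subset U$ with $A=\tau(A)$, if $x\in\tau(A\cup\{y\})$ and $x,y\notin A$, then $y\notin\tau(A\cup\{x\})$. Given a convex geometry $(U,\tau)$ and a class $\mathcal{C}$ of convex sets in $\mathbf{R}^d$, $(U,\tau)$ is representable by $\mathcal{C}$ if there exists an injection $\phi:U\to\mathcal{C}$ such that for every subset $A\subset U$ and every $u\in U$: $u\in\tau(A)$ if and only if $\phi(u)\subset\mathrm{Conv}\bigl(\bigcup_{a\in A}\phi(a)\bigr)$. For $n\ge3$, $U_n=\{a_0,a_1,g_1,\dots,g_n\}$ is a set of $n+2$ distinct elements, and $\tau_n$ is defined on subsets $A\subset U_n$ by $\tau_n(A)=U_n$ if $\{g_1,\dots,g_n\}\subset A$, and $\tau_n(A)=A$ otherwise. This is a convex geometry. *)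

(* Defs.v *)
From mathcomp Require Import all_boot all_order all_algebra.
From mathcomp Require Import all_classical all_reals all_analysis.
From mathcomp Require Import ring.

Set Implicit Arguments.
Unset Strict Implicit.
Unset Printing Implicit Defensive.

Import Order.TTheory GRing.Theory Num.Theory.
Import numFieldNormedType.Exports.

Local Open Scope classical_set_scope.
Local Open Scope ring_scope.
Local Open Scope convex_scope.

Record convex_geometry (U : Type) := ConvexGeometry {
  cl :> set U -> set U;
  cl_ext : forall A, A `<=` cl A;
  cl_mono : forall A B, A `<=` B -> cl A `<=` cl B;
  cl_idem : forall A, cl (cl A) = cl A;
  cl_set0 : cl set0 = set0;
  cl_anti_exchange : forall (x y : U) (A : set U),
    x <> y -> A = cl A -> cl (A `|` [set y]) x -> ~ A x -> ~ A y ->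
    ~ cl (A `|` [set x]) y
}.

Definition convex_hull (R : numDomainType) (V : lmodType R) (A : set V) :
  set V := smallest (@convex_set R V) A.

(* C stands for a class of convex sets; homothets_convex below checks this for
   the class of homothets of a convex set. *)
Definition representable (U : Type) (tau : convex_geometry U)
    (R : realType) (d : nat) (C : set (set 'rV[R]_d)) : Prop :=
  exists phi : U -> set 'rV[R]_d,
    [/\ injective phi,
        (forall u, C (phi u)) &
        (forall (A : set U) (u : U),
           tau A u <-> phi u `<=` convex_hull (\bigcup_(a in A) phi a))].

Definition convex_body (R : realType) (d : nat) (K : set 'rV[R]_d) : Prop :=
  [/\ compact K, convex_set K & interior K !=set0].

Definition homothets (R : realType) (d : nat) (K : set 'rV[R]_d) :
    set (set 'rV[R]_d) :=
  [set L | exists (t : 'rV[R]_d) (lambda : R),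
     0 < lambda /\ L = [set t + lambda *: x | x in K]].

Lemma homothets_convex (R : realType) (d : nat) (K L : set 'rV[R]_d) :
  convex_set K -> homothets K L -> convex_set L.
Proof.
move=> cK [t [l [_ ->]]] x y p.
rewrite !inE => -[a Ka <-] [b Kb <-].
exists ((a : convex_lmodType _) <| p |> b).
  by have := cK a b p; rewrite !inE => /(_ Ka Kb).
have convE (u v : 'rV[R]_d) : (u : convex_lmodType _) <| p |> v =
  p%:num *: u + (1 - p%:num) *: v by [].
rewrite !convE; apply/rowP => i; rewrite !mxE; ring.
Qed.

Inductive ground (n : nat) : Type := a0 | a1 | g of 'I_n.
Arguments a0 {n}.
Arguments a1 {n}.

Definition tau_fun (n : nat) (A : set (ground n)) : set (ground n) :=
  if `[< range (@g n) `<=` A >] then setT else A.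

Section tau_facts.
Variable n : nat.
Implicit Types A B : set (ground n).

Lemma tau_funE A u : tau_fun A u <-> (range (@g n) `<=` A) \/ A u.
Proof.
rewrite /tau_fun; case: asboolP => h; split=> //.
- by left.
- by right.
- by case.
Qed.

Lemma tau_ext A : A `<=` tau_fun A.
Proof. by move=> u Au; apply/tau_funE; right. Qed.

Lemma tau_mono A B : A `<=` B -> tau_fun A `<=` tau_fun B.
Proof.
move=> AB u /tau_funE[gA|/AB Bu]; apply/tau_funE; [left|by right].
exact: subset_trans gA AB.
Qed.

Lemma tau_idem A : tau_fun (tau_fun A) = tau_fun A.
Proof.
apply/seteqP; split; last exact: tau_ext.
move=> u /tau_funE[h|//]; apply/tau_funE; left => _ [i _ <-].
by have /tau_funE[gA|//] := h (g i) (ex_intro2 _ _ i I erefl); apply: gA; exists i.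
Qed.

Lemma tau_set0 : (0 < n)%N -> tau_fun (set0 : set (ground n)) = set0.
Proof.
move=> n0; rewrite /tau_fun asboolF// => /(_ (g (Ordinal n0))); apply.
by exists (Ordinal n0).
Qed.

Lemma tau_anti_exchange (x y : ground n) A : x <> y -> A = tau_fun A ->
  tau_fun (A `|` [set y]) x -> ~ A x -> ~ A y -> ~ tau_fun (A `|` [set x]) y.
Proof.
move=> xy AE /tau_funE[gAy|[//|/xy//]] nAx nAy /tau_funE[gAx|[//|/esym/xy//]].
apply: nAx; rewrite AE; apply/tau_funE; left => u gu.
have [//|uy] := gAy u gu; have [//|ux] := gAx u gu.
by case: xy; rewrite -ux -uy.
Qed.

End tau_facts.

(* The bound on n is used in cl_set0: for n = 0 the closure of set0 is setT. *)
Definition tau (n : nat) (n3 : (3 <= n)%N) : convex_geometry (ground n) :=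
  ConvexGeometry (@tau_ext n) (@tau_mono n) (@tau_idem n)
    (tau_set0 (ltn_trans (isT : (0 < 2)%N) n3)) (@tau_anti_exchange n).

(* Main.v *)
Require Import Defs.
From mathcomp Require Import all_boot all_order all_algebra.
From mathcomp Require Import all_classical all_reals all_analysis.
From mathcomp Require Import ring lra.

Set Implicit Arguments.
Unset Strict Implicit.
Unset Printing Implicit Defensive.

Import Order.TTheory GRing.Theory Num.Theory.
Import numFieldNormedType.Exports.

Local Open Scope classical_set_scope.
Local Open Scope ring_scope.

(** Everything is read off support functions.  If h is the support function of
    K, the support function of t + r K is u |-> <u, t> + r h(u), so two
    homothets are compared through functions <u, t> + r h(u), which are
    concave on the plane as soon as r <= 0.

    Suppose that a representation exists and let the images of a0 and a1 be
    called A and B in such an order that the ratio of A is at most that of B.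
    Since A lies in the hull of the bodies G_i, but not in the hull of B and the
    G_i with i <> k, separation (nsub_hull_supp, sub_hull_supp) yields for every
    k a direction U_k in which A exceeds B, exceeds every G_i with i <> k, and does
    not exceed G_k.  Exchanging A and B yields directions V_k in the same way.

    The directions where A exceeds B form a convex cone, because the difference
    of the support functions of A and B is concave.  Among three vectors of
    this cone one lies in the cone of the other two (positive_middle): this is
    where n >= 3 enters.  Say U_2 is in the cone of U_1 and U_3.  Let g be the
    support function of G_2 minus that of A.  Then g is negative at U_1 and U_3,
    and nonnegative at U_2, so g is not convex; hence G_2 has a
    smaller ratio than A, and g is concave.  Thus g >= 0 also holds on the cone
    spanned by U_2 and V_2, where V_2 lies outside the cone of directions in
    which A exceeds B.  Hence a rotation from U_2 towards V_2, through less
    than a half-turn, passes U_1 or U_3 before it arrives, so that one of these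
    lies in the cone of U_2 and V_2; this contradicts g < 0 there.  The one
    escape, V_2 opposite to U_2, is ruled out because K has positive width
    (no_alternation). *)

(** * Separation of a point from a compact convex set *)

Definition dot (R : realType) (d : nat) (u x : 'rV[R]_d) : R :=
  \sum_i u 0 i * x 0 i.

Section dot_product.
Variables (R : realType) (d : nat).
Implicit Types (u v x y : 'rV[R]_d) (a : R) (A B C S : set 'rV[R]_d).

Lemma dotC u v : dot u v = dot v u.
Proof. by apply: eq_bigr => i _; rewrite mulrC. Qed.

Lemma dotDr u x y : dot u (x + y) = dot u x + dot u y.
Proof. by rewrite -big_split; apply: eq_bigr => i _; rewrite mxE mulrDr. Qed.

Lemma dotZr u a x : dot u (a *: x) = a * dot u x.
Proof. by rewrite mulr_sumr; apply: eq_bigr => i _; rewrite mxE mulrCA. Qed.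

Lemma dotNr u x : dot u (- x) = - dot u x.
Proof. by rewrite -scaleN1r dotZr mulN1r. Qed.

Lemma dotDl u v x : dot (u + v) x = dot u x + dot v x.
Proof. by rewrite !(dotC _ x) dotDr. Qed.

Lemma dotZl a u x : dot (a *: u) x = a * dot u x.
Proof. by rewrite !(dotC _ x) dotZr. Qed.

Lemma dotNl u x : dot (- u) x = - dot u x.
Proof. by rewrite !(dotC _ x) dotNr. Qed.

Lemma dot_gt0 u : u != 0 -> 0 < dot u u.
Proof.
move=> u0; rewrite lt_neqAle eq_sym sumr_ge0 ?andbT; last first.
  by move=> i _; rewrite -expr2 sqr_ge0.
apply: contra_neq u0 => /eqP; rewrite psumr_eq0; last first.
  by move=> i _; rewrite -expr2 sqr_ge0.
move=> /allP u0; apply/rowP => i; rewrite mxE.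
by have := u0 i (mem_index_enum i); rewrite /= mulf_eq0 orbb => /eqP.
Qed.

Lemma continuous_dot (T : topologicalType) (f g : T -> 'rV[R]_d) :
  continuous f -> continuous g -> continuous (fun x : T => dot (f x) (g x)).
Proof.
move=> cf cg; apply: continuous_big => [|i _ x]; first exact: add_continuous.
apply: cvgM.
  exact: (continuous_comp (cf x) (@coord_continuous _ _ _ 0 i (f x))).
exact: (continuous_comp (cg x) (@coord_continuous _ _ _ 0 i (g x))).
Qed.

(** Real weights in place of the bundled elements of the unit interval, so that
    convexity can be used with weights produced by arithmetic. *)
Lemma convex_setP (A : set 'rV[R]_d) : convex_set A <->
  forall x y t, A x -> A y -> 0 <= t -> t <= 1 -> A (t *: x + (1 - t) *: y).
Proof.
split=> [cA x y t Ax Ay t0 t1|cA x y p].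
  by have := cA x y (Itv01 t0 t1); rewrite !inE; apply.
by rewrite !inE => Ax Ay; apply: cA.
Qed.

(** The nearest point q of C to p exists by compactness, and p - q separates:
    if <p - q, x - q> were positive for some x in C, a short step from q towards
    x would bring the point closer to p. *)
Lemma separate_point (C : set 'rV[R]_d) (p : 'rV[R]_d) :
  compact C -> convex_set C -> C !=set0 -> ~ C p ->
  exists u, forall x, C x -> dot u x < dot u p.
Proof.
move=> compC /convex_setP convC C0 nCp.
have cD : continuous (fun x => dot (x - p) (x - p)).
  have cB : continuous (fun x : 'rV[R]_d => x - p).
    by move=> x; apply: continuousB; [exact: id|exact: cst_continuous].
  exact: continuous_dot.
have [q] := compact_EVT_min C0 compC (continuous_subspaceT cD).
rewrite inE => Cq qmin.
have u0 : p - q != 0 by apply/eqP => /subr0_eq pq; apply: nCp; rewrite pq.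
exists (p - q) => x Cx.
suff : dot (p - q) (x - q) <= 0.
  have := dot_gt0 u0; rewrite !(dotDr, dotNr); lra.
rewrite leNgt; apply/negP => c0.
set c := dot _ _ in c0; pose m := dot (x - q) (x - q).
(* Comparing the squared distances from p to q and to q + t (x - q). *)
have key t : 0 <= t -> t <= 1 -> 0 <= t * (t * m - 2 * c).
  move=> t0 t1; have := qmin _ (mem_set (convC x q t Cx Cq t0 t1)).
  have -> : t *: x + (1 - t) *: q - p = (q - p) + t *: (x - q).
    by apply/rowP => i; rewrite !mxE; ring.
  have -> : c = - dot (q - p) (x - q) by rewrite -dotNl opprB.
  rewrite /m; move: (q - p) (x - q) => w y.
  rewrite !(dotDl, dotDr, dotZl, dotZr) (dotC y w).
  lra.
(* The decrease is largest at t = c / m, or at t = 1 if that is beyond x. *)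
have [mc|cm] := leP m c.
  by have := key 1 ler01 (lexx 1); lra.
have m0 : 0 < m by apply: lt_trans cm.
have cm1 : c / m <= 1 by rewrite ler_pdivrMr// mul1r ltW.
have := key (c / m) (divr_ge0 (ltW c0) (ltW m0)) cm1.
rewrite divfK ?gt_eqF// pmulr_rge0 ?divr_gt0//; lra.
Qed.

(** * Compactness of the hull of finitely many compact convex sets *)

(** Written as an image of [0, 1] x A x B so that compactness is inherited from
    the product. *)
Definition segment_join (A B : set 'rV[R]_d) : set 'rV[R]_d :=
  [set z.1 *: z.2.1 + (1 - z.1) *: z.2.2 | z in `[0, 1]%classic `*` (A `*` B)].

Lemma compact_segment_join A B :
  compact A -> compact B -> compact (segment_join A B).
Proof.
move=> cA cB; apply: continuous_compact; last first.
  apply: compact_setX; first exact: segment_compact.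
  exact: compact_setX.
apply: continuous_subspaceT => z; apply: cvgD; apply: cvgZ.
- exact: cvg_fst.
- by apply: cvg_comp cvg_snd _; exact: cvg_fst.
- by apply: cvgB; [exact: cvg_cst|exact: cvg_fst].
- by apply: cvg_comp cvg_snd _; exact: cvg_snd.
Qed.

(** Unnormalized weights avoid dividing by zero when regrouping the four points
    in convex_segment_join. *)
Lemma convex_cone_comb (A : set 'rV[R]_d) x y a b : convex_set A ->
  A x -> A y -> 0 <= a -> 0 <= b ->
  exists2 z, A z & a *: x + b *: y = (a + b) *: z.
Proof.
move=> /convex_setP cA Ax Ay a0 b0.
have [ab0|ab0] := eqVneq (a + b) 0.
  have -> : a = 0 by lra.
  have -> : b = 0 by lra.
  by exists x => //; rewrite addr0 !scale0r addr0.
exists ((a / (a + b)) *: x + (1 - a / (a + b)) *: y).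
  apply: cA => //; first by rewrite divr_ge0// addr_ge0.
  by rewrite ler_pdivrMr ?mul1r ?lerDl// lt_def ab0 addr_ge0.
by rewrite scalerDr !scalerA; congr (_ *: _ + _ *: _); field.
Qed.

Lemma convex_segment_join A B :
  convex_set A -> convex_set B -> convex_set (segment_join A B).
Proof.
move=> cA cB; apply/convex_setP => p q t.
move=> [[s [x y]] [/= s01 [/= Ax By]] <-{p}].
move=> [[s' [x' y']] [/= s'01 [/= Ax' By']] <-{q}].
move=> t0 t1 /=; move: s01 s'01; rewrite !in_itv/= => /andP[s0 s1] /andP[s'0 s'1].
have [||a Aa aE] := convex_cone_comb cA Ax Ax' (a := t * s) (b := (1 - t) * s').
- by rewrite mulr_ge0.
- by rewrite mulr_ge0// subr_ge0.
have [||b Bb bE] :=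
    convex_cone_comb cB By By' (a := t * (1 - s)) (b := (1 - t) * (1 - s')).
- by rewrite mulr_ge0// subr_ge0.
- by rewrite mulr_ge0// subr_ge0.
exists (t * s + (1 - t) * s', (a, b)) => /=.
  split=> //=; rewrite in_itv/=; apply/andP; split; nra.
have -> : 1 - (t * s + (1 - t) * s') = t * (1 - s) + (1 - t) * (1 - s') by ring.
rewrite -aE -bE !scalerDr !scalerA -!addrA; congr (_ + _).
by rewrite addrCA.
Qed.

Lemma convex_convex_hull (A : set 'rV[R]_d) : convex_set (convex_hull A).
Proof.
apply/convex_setP => x y t Ax Ay t0 t1 B [cB AB].
by move/convex_setP: (cB); apply=> //; [apply: Ax|apply: Ay].
Qed.

(** Both sets must be nonempty: the join with the empty set is empty. *)
Lemma convex_hullU_join A B : convex_set A -> convex_set B ->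
  A !=set0 -> B !=set0 -> convex_hull (A `|` B) = segment_join A B.
Proof.
move=> cA cB [a Aa] [b Bb]; apply/seteqP; split.
  apply: smallest_sub; first exact: convex_segment_join.
  move=> x [Ax|Bx].
    exists (1, (x, b)) => /=; first by split => //=; rewrite in_itv/= ler01 lexx.
    by rewrite subrr scale1r scale0r addr0.
  exists (0, (a, x)) => /=; first by split => //=; rewrite in_itv/= ler01 lexx.
  by rewrite subr0 scale1r scale0r add0r.
move=> _ [[t [x y]] [/= t01 [/= Ax By]] <-] /=.
move: t01; rewrite in_itv/= => /andP[t0 t1].
have /convex_setP cAB := @convex_convex_hull (A `|` B).
by apply: cAB => //; apply: sub_gen_smallest; [left|right].
Qed.

Lemma compact_convex_hullU A B : convex_set A -> convex_set B ->
  compact A -> compact B -> compact (convex_hull (A `|` B)).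
Proof.
move=> cA cB compA compB.
have [->|/set0P A0] := eqVneq A set0.
  by rewrite set0U /convex_hull smallest_id.
have [->|/set0P B0] := eqVneq B set0.
  by rewrite setU0 /convex_hull smallest_id.
by rewrite convex_hullU_join//; exact: compact_segment_join.
Qed.

Lemma convex_hullU_hull A B :
  convex_hull (A `|` convex_hull B) = convex_hull (A `|` B).
Proof.
apply/seteqP; split.
  apply: smallest_sub; first exact: convex_convex_hull.
  move=> x [Ax|]; first by apply: sub_gen_smallest; left.
  by apply: sub_smallest2r; [exact: convex_convex_hull|right].
apply: sub_smallest2r; first exact: convex_convex_hull.
by apply: setUS; exact: sub_gen_smallest.
Qed.

(** The hull may be formed by adding one set at a time, and each step is the
    hull of a union of two compact convex sets. *)
Lemma compact_convex_hull_bigcup (I : Type) (D : set I)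
    (F : I -> set 'rV[R]_d) :
  finite_set D -> (forall i, convex_set (F i)) -> (forall i, compact (F i)) ->
  compact (convex_hull (\bigcup_(i in D) F i)).
Proof.
move=> + cF compF; elim/Pchoice: I => I in D F cF compF *.
move=> /finite_seqP[s ->]; elim: s => [|i s IHs].
  rewrite set_nil bigcup_set0 /convex_hull smallest_id; first exact: compact0.
  by move=> x y p; rewrite inE.
have -> : [set` i :: s] = i |` [set` s].
  by apply/seteqP; split=> j /=; rewrite inE => /predU1P.
rewrite bigcup_setU1 -convex_hullU_hull; apply: compact_convex_hullU => //.
exact: convex_convex_hull.
Qed.

(** * Support functions *)

Definition supp (S : set 'rV[R]_d) (u : 'rV[R]_d) : R :=
  sup [set dot u x | x in S].

Lemma supp_attained S u : compact S -> S !=set0 ->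
  exists2 x, S x & dot u x = supp S u /\ forall y, S y -> dot u y <= supp S u.
Proof.
move=> compS S0.
have cD : continuous (dot u).
  by apply: continuous_dot => x; [exact: cst_continuous|exact: id].
have [x] := compact_EVT_max S0 compS (continuous_subspaceT cD).
rewrite inE => Sx xmax; exists x => //.
have xE : dot u x = supp S u.
  apply/eqP; rewrite eq_le; apply/andP; split.
    apply: ub_le_sup; last by exists x.
    by exists (dot u x) => _ [y Sy <-]; apply: xmax; rewrite inE.
  apply: ge_sup; first by exists (dot u x), x.
  by move=> _ [y Sy <-]; apply: xmax; rewrite inE.
by split=> // y Sy; rewrite -xE; apply: xmax; rewrite inE.
Qed.

Lemma convex_halfspace u a : convex_set [set x | dot u x < a].
Proof.
apply/convex_setP => x y t /= xa ya t0 t1; rewrite dotDr !dotZr.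
have [->|tn0] := eqVneq t 0; first by lra.
have : 0 < t by rewrite lt_def tn0.
nra.
Qed.

(** Otherwise an open half-space orthogonal to u would contain all the F i,
    hence their hull, but miss a point where S attains its support. *)
Lemma sub_hull_supp (I : Type) (D : set I) (F : I -> set 'rV[R]_d) S u :
  (forall i, compact (F i)) -> (forall i, F i !=set0) ->
  compact S -> S !=set0 -> S `<=` convex_hull (\bigcup_(i in D) F i) ->
  exists2 i, D i & supp S u <= supp (F i) u.
Proof.
move=> compF F0 compS S0 SF; apply: contrapT => /forall2NP nle.
have [p Sp [pE _]] := supp_attained u compS S0.
have : dot u p < supp S u.
  apply: (SF p Sp [set x | dot u x < supp S u]); split.
    exact: convex_halfspace.
  move=> x [i Di Fx] /=; have [_ _ [_ ub]] := supp_attained u (compF i) (F0 i).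
  by apply: le_lt_trans (ub x Fx) _; case: (nle i) => // /negP; rewrite -ltNge.
by rewrite pE ltxx.
Qed.

(** A point of S outside the hull can be separated from it because the hull is
    compact; the inequality survives the passage to the supremum over F i
    because that supremum is attained. *)
Lemma nsub_hull_supp (I : Type) (D : set I) (F : I -> set 'rV[R]_d) S :
  finite_set D -> D !=set0 -> (forall i, convex_set (F i)) ->
  (forall i, compact (F i)) -> (forall i, F i !=set0) ->
  compact S -> ~ S `<=` convex_hull (\bigcup_(i in D) F i) ->
  exists u, forall i, D i -> supp (F i) u < supp S u.
Proof.
move=> finD [i0 Di0] cF compF F0 compS nSF.
have [p Sp np] : exists2 p, S p & ~ convex_hull (\bigcup_(i in D) F i) p.
  apply: contrapT => /forall2NP h; apply: nSF => p Sp.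
  by case: (h p) => // /contrapT.
have Fhull i : D i -> F i `<=` convex_hull (\bigcup_(i in D) F i).
  by move=> Di x Fx; apply: sub_gen_smallest; exists i.
have [||u up] := separate_point _ (@convex_convex_hull _) _ np.
- exact: compact_convex_hull_bigcup.
- by have [x Fx] := F0 i0; exists x; exact: Fhull Fx.
exists u => i Di; have [x Fx [<- _]] := supp_attained u (compF i) (F0 i).
have [_ _ [_ ub]] := supp_attained u compS (ex_intro _ p Sp).
by apply: lt_le_trans (ub p Sp); apply: up; exact: Fhull Fx.
Qed.

Section support_function.
Variable K : set 'rV[R]_d.
Hypotheses (compK : compact K) (K0 : K !=set0).
Local Notation h := (supp K).

Lemma suppZ a u : 0 <= a -> h (a *: u) = a * h u.
Proof.
move=> a0.
have [x Kx [xE xub]] := supp_attained u compK K0.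
have [y Ky [yE yub]] := supp_attained (a *: u) compK K0.
apply/eqP; rewrite eq_le; apply/andP; split.
  by rewrite -yE dotZl ler_wpM2l// xub.
by rewrite -xE -dotZl yub.
Qed.

Lemma suppD u v : h (u + v) <= h u + h v.
Proof.
have [x Kx [xE _]] := supp_attained (u + v) compK K0.
have [_ _ [_ uub]] := supp_attained u compK K0.
have [_ _ [_ vub]] := supp_attained v compK K0.
by rewrite -xE dotDl lerD ?uub ?vub.
Qed.

(** K contains a segment of direction u around an interior point, and
    h u + h (- u) is at least the variation of <u, .> along it. *)
Lemma supp_width u : interior K !=set0 -> u != 0 -> 0 < h u + h (- u).
Proof.
move=> [x Kx] u0.
have [e e0 [Kp Km]] : exists2 e : R, 0 < e & K (x + e *: u) /\ K (x + (- e) *: u).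
  have cl : (fun e : R => x + e *: u) @ 0 --> x.
    rewrite -[X in _ --> X]addr0 -(scale0r u).
    by apply: cvgD; [exact: cvg_cst|apply: cvgZr_tmp; exact: cvg_id].
  have := cl _ Kx; rewrite nbhs_filterE => /nbhs_ballP[e /= e0 eK].
  have e20 : 0 < e / 2 by rewrite divr_gt0.
  have e2e : `|e / 2| < e by rewrite gtr0_norm// gtr_pMr// invf_lt1// ltr1n.
  exists (e / 2) => //; split; apply: eK; rewrite /ball/= sub0r.
    by rewrite normrN.
  by rewrite opprK.
have [_ _ [_ uub]] := supp_attained u compK K0.
have [_ _ [_ nub]] := supp_attained (- u) compK K0.
have := uub _ Kp; have := nub _ Km; rewrite !dotDr !dotZr !dotNl.
have := dot_gt0 u0; nra.
Qed.

Lemma supp_homothet t a u : 0 < a ->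
  supp [set t + a *: x | x in K] u = dot u t + a * h u.
Proof.
move=> a0; have [x Kx [xE xub]] := supp_attained u compK K0.
apply/eqP; rewrite eq_le; apply/andP; split.
  apply: ge_sup; first by exists (dot u (t + a *: x)), (t + a *: x) => //; exists x.
  by move=> _ [_ [y Ky <-] <-]; rewrite dotDr dotZr lerD2l ler_pM2l// xub.
apply: ub_le_sup.
  exists (dot u t + a * h u) => _ [_ [y Ky <-] <-].
  by rewrite dotDr dotZr lerD2l ler_pM2l// xub.
by exists (t + a *: x); [exists x|rewrite dotDr dotZr xE].
Qed.

Lemma compact_homothet t a : compact [set t + a *: x | x in K].
Proof.
apply: continuous_compact => //; apply: continuous_subspaceT => x.
by apply: continuousD; [exact: cst_continuous|exact: scaler_continuous].
Qed.
End support_function.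
End dot_product.

(** * Directions in the plane *)

Section planar_directions.
Variable R : realType.
Implicit Types (u v w x y : 'rV[R]_2) (a b c : R) (f : 'rV[R]_2 -> R).

Definition superlinear f :=
  (forall x y, f x + f y <= f (x + y)) /\
  (forall a x, 0 <= a -> f (a *: x) = a * f x).

Definition det2 u v := u 0 0 * v 0 1 - u 0 1 * v 0 0.

Lemma superlinear_comb f x y a b : superlinear f -> 0 <= a -> 0 <= b ->
  a * f x + b * f y <= f (a *: x + b *: y).
Proof. by move=> [fD fZ] a0 b0; rewrite -!fZ. Qed.

Lemma superlinear0 f : superlinear f -> f 0 = 0.
Proof. by move=> [_ fZ]; rewrite -(scale0r 0) fZ// mul0r. Qed.

Lemma row2_eq u v : u 0 0 = v 0 0 -> u 0 1 = v 0 1 -> u = v.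
Proof.
move=> e0 e1; apply/rowP => -[[|[|//]] i2].
  by rewrite (_ : Ordinal i2 = 0) //; exact/val_inj.
by rewrite (_ : Ordinal i2 = 1) //; exact/val_inj.
Qed.

(** Cramer's rule, in a form which makes sense for dependent vectors too. *)
Lemma det2_dependency u v w :
  det2 v w *: u + det2 w u *: v + det2 u v *: w = 0.
Proof. by apply: row2_eq; rewrite !mxE /det2; ring. Qed.

Lemma det2_eq0 u v : u != 0 -> det2 u v = 0 -> exists a, v = a *: u.
Proof.
move=> u0; rewrite /det2 => uv.
have [u00|u00] := eqVneq (u 0 0) 0; last first.
  exists (v 0 0 / u 0 0); apply: row2_eq; rewrite !mxE; first by field.
  apply: (mulfI u00); have -> : u 0 0 * v 0 1 = u 0 1 * v 0 0 by lra.
  by field.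
have u01 : u 0 1 != 0.
  by apply: contra_neq u0 => u01; apply: row2_eq; rewrite mxE.
exists (v 0 1 / u 0 1); apply: row2_eq; rewrite !mxE; last by field.
apply: (mulfI u01); have -> : u 0 1 * v 0 0 = u 0 0 * v 0 1 by lra.
by rewrite u00; ring.
Qed.

(** When v and w are on the same side of the line through u, rotating from u one
    meets either w before v, or v before w; the one met first lies in the cone
    of u and the other. *)
Lemma same_side u v w : 0 < det2 u v * det2 u w ->
  (exists a b, [/\ 0 <= a, 0 <= b & w = a *: u + b *: v]) \/
  (exists a b, [/\ 0 <= a, 0 <= b & v = a *: u + b *: w]).
Proof.
wlog : v w / det2 w v * det2 u v >= 0 => [hwlog|wv] uvw.
  have [wv|wv] := leP 0 (det2 w v * det2 u v); first exact: hwlog.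
  have vw : 0 <= det2 v w * det2 u w.
    have -> : det2 v w = - det2 w v by rewrite /det2; ring.
    rewrite mulNr oppr_ge0 leNgt; apply/negP => wu.
    have := mulr_gt0 wu uvw.
    have := mulr_le0_ge0 (ltW wv) (sqr_ge0 (det2 u w)); lra.
  have uwv : 0 < det2 u w * det2 u v by rewrite mulrC.
  by have [H|H] := hwlog w v vw uwv; [right|left].
left; have uv0 : det2 u v != 0.
  by apply: contra_ltN uvw => /eqP ->; rewrite mul0r.
have uv2 : 0 < det2 u v ^+ 2 by rewrite exprn_even_gt0.
exists (det2 w v / det2 u v), (det2 u w / det2 u v); split.
- rewrite -(pmulr_lge0 _ uv2).
  by have -> : det2 w v / det2 u v * det2 u v ^+ 2 = det2 w v * det2 u v by field.
- rewrite -(pmulr_lge0 _ uv2).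
  have -> : det2 u w / det2 u v * det2 u v ^+ 2 = det2 u v * det2 u w by field.
  exact: ltW.
by apply: row2_eq; rewrite !mxE; move: uv0; rewrite /det2 => uv0; field.
Qed.

Section positive_directions.
Variable f : 'rV[R]_2 -> R.
Hypothesis f_sl : superlinear f.

(** Apply f to the relation: f 0 = 0 is at least a f u + b f v + c f w. *)
Lemma positive_independent u v w a b c : 0 < f u -> 0 < f v -> 0 < f w ->
  0 <= a -> 0 <= b -> 0 <= c -> a *: u + b *: v + c *: w = 0 ->
  [/\ a = 0, b = 0 & c = 0].
Proof.
move=> fu fv fw a0 b0 c0 e.
have := superlinear_comb u v f_sl a0 b0.
have := superlinear_comb (a *: u + b *: v) w f_sl ler01 c0.
rewrite scale1r e superlinear0// mul1r => h1 h2.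
have := mulr_ge0 a0 (ltW fu); have := mulr_ge0 b0 (ltW fv).
have := mulr_ge0 c0 (ltW fw) => *.
have /eqP : a * f u = 0 by lra.
have /eqP : b * f v = 0 by lra.
have /eqP : c * f w = 0 by lra.
rewrite !mulf_eq0 !(gt_eqF fu, gt_eqF fv, gt_eqF fw) !orbF.
by move=> /eqP-> /eqP-> /eqP->.
Qed.

(** Three vectors in the plane are linearly dependent, and by
    positive_independent the coefficients cannot all have the same sign: the
    vector whose coefficient has a sign of its own is in the cone of the
    others. *)
Lemma positive_middle u v w : 0 < f u -> 0 < f v -> 0 < f w ->
  exists a b, [/\ 0 <= a, 0 <= b &
    [\/ u = a *: v + b *: w, v = a *: u + b *: w | w = a *: u + b *: v]].
Proof.
move=> fu fv fw.
have u0 : u != 0 by apply: contraTneq fu => ->; rewrite superlinear0// ltxx.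
have solve a b c (x y z : 'rV[R]_2) : a < 0 -> 0 <= b -> 0 <= c ->
    a *: x + b *: y + c *: z = 0 ->
    [/\ 0 <= b / - a, 0 <= c / - a & x = b / - a *: y + c / - a *: z].
  move=> a0 b0 c0 e; have na0 : 0 < - a by lra.
  rewrite !divr_ge0 ?(ltW na0)//; split=> //.
  apply/eqP; rewrite -subr_eq0 -(inj_eq (scalerI (lt0r_neq0 na0))) scaler0.
  rewrite -oppr_eq0 -e; apply/eqP/rowP => i; rewrite !mxE.
  by field; rewrite lt_eqF.
pose P := exists a b, [/\ 0 <= a, 0 <= b &
  [\/ u = a *: v + b *: w, v = a *: u + b *: w | w = a *: u + b *: v]].
have Hu a b c : a < 0 -> 0 <= b -> 0 <= c -> a *: u + b *: v + c *: w = 0 -> P.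
  move=> a0 b0 c0 /(solve _ _ _ _ _ _ a0 b0 c0)[p0 q0 e].
  by exists (b / - a), (c / - a); split=> //; apply: Or31.
have Hv a b c : 0 <= a -> b < 0 -> 0 <= c -> a *: u + b *: v + c *: w = 0 -> P.
  rewrite [_ *: u + _]addrC => a0 b0 c0 /(solve _ _ _ _ _ _ b0 a0 c0)[p0 q0 e].
  by exists (a / - b), (c / - b); split=> //; apply: Or32.
have Hw a b c : 0 <= a -> 0 <= b -> c < 0 -> a *: u + b *: v + c *: w = 0 -> P.
  rewrite addrC addrA => a0 b0 c0 /(solve _ _ _ _ _ _ c0 a0 b0)[p0 q0 e].
  by exists (a / - c), (b / - c); split=> //; apply: Or33.
(* The relation has a sign pattern covered by Hu, Hv or Hw, or its opposite has,
   or all coefficients have the same sign. *)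
have dep := det2_dependency u v w.
have ndep : - det2 v w *: u + - det2 w u *: v + - det2 u v *: w = 0.
  by rewrite !scaleNr -!opprD dep oppr0.
have ge0 := positive_independent fu fv fw _ _ _ dep.
have le0 := positive_independent fu fv fw _ _ _ ndep.
have [vw|vw] := leP 0 (det2 v w); have [wu|wu] := leP 0 (det2 w u);
  have [uv|uv] := leP 0 (det2 u v).
(* All three determinants vanish, so the vectors are on one ray. *)
- have [_ _ uv0] := ge0 vw wu uv.
  have [k vE] := det2_eq0 u0 uv0.
  have [k0|k0] := leP 0 k.
    by exists k, 0; split=> //; apply: Or32; rewrite scale0r addr0.
  have [|||//|/eqP] := @positive_independent u v w (- k) 1 0 fu fv fw.
  - lra.
  - exact: ler01.
  - exact: lexx.
  - by rewrite vE scale1r scaleNr addNr scale0r add0r.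
  by move=> _ /eqP; rewrite oner_eq0.
- exact: Hw dep.
- exact: Hv dep.
- have [vw0|vw0] := ltP 0 (det2 v w); first by apply: Hu ndep; lra.
  have [|||_ /eqP] := le0; by lra.
- exact: Hu dep.
- have [wu0|wu0] := ltP 0 (det2 w u); first by apply: Hv ndep; lra.
  have [|||] := le0; by lra.
- have [uv0|uv0] := ltP 0 (det2 u v); first by apply: Hw ndep; lra.
  have [|||] := le0; by lra.
- have [|||] := le0; by lra.
Qed.

(** The set where g is nonnegative contains v and x but not u and w, although v
    is between u and w.  In the setting of f, x is not between u and w, so that
    u, v, w, x alternate around the origin; but the set where g is nonnegative
    is a convex cone without opposite vectors, and such a set meets the circle
    of directions in an arc. *)
Lemma no_alternation (g : 'rV[R]_2 -> R) u v w x a b :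
  superlinear g -> (forall y, y != 0 -> g y + g (- y) < 0) ->
  0 < f u -> 0 < f v -> 0 < f w -> f x < 0 ->
  g u < 0 -> 0 <= g v -> g w < 0 -> 0 <= g x ->
  0 <= a -> 0 <= b -> v != a *: u + b *: w.
Proof.
move=> g_sl gN fu fv fw fx gu gv gw gx a0 b0; apply/eqP => vE.
have v0 : v != 0 by apply: contraTneq fv => ->; rewrite superlinear0// ltxx.
have a_gt0 : 0 < a.
  rewrite lt_neqAle a0 andbT; apply/eqP => a_eq0.
  move: gv; rewrite vE -a_eq0 scale0r add0r; case: g_sl => _ -> //.
  rewrite leNgt nmulr_llt0// lt_neqAle b0 andbT => /negP; apply.
  by apply: contra_neq v0 => b_eq0; rewrite vE -a_eq0 -b_eq0 !scale0r addr0.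
have b_gt0 : 0 < b.
  rewrite lt_neqAle b0 andbT; apply/eqP => b_eq0.
  move: gv; rewrite vE -b_eq0 scale0r addr0; case: g_sl => _ -> //.
  by rewrite leNgt nmulr_llt0// a_gt0.
(* This applies to y = u and y = w.  If y is in the cone of v and x, then g y
   is nonnegative; if x is in the cone of v and y, then f x is positive. *)
have side y : 0 < f y -> g y < 0 -> ~ 0 < det2 v x * det2 v y.
  move=> fy gy /same_side[] [c [d [c0 d0 e]]].
    have := superlinear_comb v x g_sl c0 d0; rewrite -e.
    have := mulr_ge0 c0 gv; have := mulr_ge0 d0 gx; lra.
  have := superlinear_comb v y f_sl c0 d0; rewrite -e.
  have := mulr_ge0 c0 (ltW fv); have := mulr_ge0 d0 (ltW fy); lra.
(* But u and w are on opposite sides of the line through v. *)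
have dE : a * det2 v u + b * det2 v w = 0 by rewrite vE /det2 !mxE; ring.
have [vx|vx] := eqVneq (det2 v x) 0.
  have [c xE] := det2_eq0 v0 vx.
  have [c0|c0] := leP 0 c.
    move: fx; rewrite xE; case: f_sl => _ ->//.
    have := mulr_ge0 c0 (ltW fv); lra.
  have nc0 : 0 <= - c by lra.
  case: (g_sl) => _ gZ; have := gN v v0.
  move: gx; have -> : x = (- c) *: (- v) by rewrite scaleNr scalerN opprK.
  rewrite gZ// pmulr_rge0; lra.
have [vu|vu] := eqVneq (det2 v u) 0.
  have [c uE] := det2_eq0 v0 vu.
  have [c0|c0] := leP 0 c.
    by move: gu; rewrite uE; case: g_sl => _ ->//; have := mulr_ge0 c0 gv; lra.
  have := @positive_independent u v v 1 (- c) 0 fu fv fv ler01.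
  case=> //; first by lra.
    by rewrite uE scale1r scaleNr subrr scale0r addr0.
  by move=> /eqP; rewrite oner_eq0.
have [s|s] := ltP 0 (det2 v x * det2 v u); first exact: side s.
apply: (side w) => //.
have s' : det2 v x * det2 v u < 0.
  by rewrite lt_neqAle s andbT mulf_neq0.
rewrite -(pmulr_rgt0 _ b_gt0).
have -> : b * (det2 v x * det2 v w) = - a * (det2 v x * det2 v u).
  by rewrite mulrCA (_ : b * det2 v w = - a * det2 v u); [ring|lra].
by rewrite nmulr_rgt0// oppr_lt0.
Qed.
End positive_directions.
End planar_directions.

(** * Homothets of a plane convex body *)

Section homothets_in_the_plane.
Variables (R : realType) (K : set 'rV[R]_2).
Hypotheses (compK : compact K) (K_int : interior K !=set0).
Local Notation h := (supp K).

Let K0 : K !=set0.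
Proof. by case: K_int => x /interior_subset Kx; exists x. Qed.

Lemma superlinear_supp_diff (t : 'rV[R]_2) (r : R) : r <= 0 ->
  superlinear (fun u => dot u t + r * h u).
Proof.
move=> r0; split=> [x y|a x a0]; last by rewrite dotZl suppZ//; ring.
rewrite dotDl.
have : r * (h x + h y) <= r * h (x + y) by rewrite ler_wnM2l// suppD.
lra.
Qed.

(** A, B and C are the support functions of three homothets.  The difference
    A - B plays the role of f in no_alternation, and C - A that of g. *)
Lemma no_alternating_homothets (ta tb tc : 'rV[R]_2) (ra rb rc : R)
    (u v w x : 'rV[R]_2) (a b : R) :
  let A y := dot y ta + ra * h y in
  let B y := dot y tb + rb * h y in
  let C y := dot y tc + rc * h y in
  ra <= rb -> B u < A u -> B v < A v -> B w < A w -> A x < B x ->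
  C u < A u -> A v <= C v -> C w < A w -> B x <= C x ->
  0 <= a -> 0 <= b -> v != a *: u + b *: w.
Proof.
move=> A B C rab Bu Bv Bw Bx Cu Cv Cw Cx a0 b0; apply/negP => /eqP vE.
pose f y := dot y (ta - tb) + (ra - rb) * h y.
have fE y : f y = A y - B y by rewrite /f /A /B dotDr dotNr; ring.
have f_sl : superlinear f by apply: superlinear_supp_diff; lra.
pose g y := dot y (tc - ta) + (rc - ra) * h y.
have gE y : g y = C y - A y by rewrite /g /A /C dotDr dotNr; ring.
(* Otherwise C - A is convex, and as it is negative at u and w it would be
   negative at v. *)
have rca : rc < ra.
  rewrite ltNge; apply/negP => rac.
  have ng_sl : superlinear (fun y => dot y (ta - tc) + (ra - rc) * h y).
    by apply: superlinear_supp_diff; lra.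
  have ngE y : dot y (ta - tc) + (ra - rc) * h y = A y - C y.
    by rewrite /A /C dotDr dotNr; ring.
  have := superlinear_comb u w ng_sl a0 b0; rewrite -vE !ngE => le.
  have Au : 0 < A u - C u by lra.
  have Aw : 0 < A w - C w by lra.
  have := mulr_ge0 a0 (ltW Au); have := mulr_ge0 b0 (ltW Aw) => aAu bAw.
  have /eqP : a * (A u - C u) = 0 by lra.
  have /eqP : b * (A w - C w) = 0 by lra.
  rewrite !mulf_eq0 (gt_eqF Au) (gt_eqF Aw) !orbF => /eqP b00 /eqP a00.
  have v0 : v = 0 by rewrite vE a00 b00 !scale0r addr0.
  have := superlinear0 f_sl; rewrite -v0 fE; lra.
have g_sl : superlinear g by apply: superlinear_supp_diff; lra.
have gN y : y != 0 -> g y + g (- y) < 0.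
  move=> y0; have := supp_width compK K0 K_int y0.
  rewrite /g dotNl => hw.
  have : (rc - ra) * (h y + h (- y)) < 0 by rewrite nmulr_rlt0//; lra.
  lra.
suff /eqP : v != a *: u + b *: w by [].
by apply: (no_alternation f_sl g_sl gN (x := x)); rewrite ?fE ?gE; lra.
Qed.

End homothets_in_the_plane.

Theorem corollary13 (R : realType) (n : nat) (n3 : (3 <= n)%N)
    (K : set 'rV[R]_2) (hK : convex_body K) :
  ~ representable (tau n3) (homothets K).
Proof.
case: hK => compK convK K_int [phi [_ phiK phiP]].
have K0 : K !=set0 by case: K_int => x /interior_subset Kx; exists x.
have /choice[p pP] : forall i, exists p : 'rV[R]_2 * R,
    0 < p.2 /\ phi i = [set p.1 + p.2 *: x | x in K].
  by move=> i; have [t [r [r0 E]]] := phiK i; exists (t, r).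
have conv_phi i : convex_set (phi i).
  exact: homothets_convex convK (phiK i).
have comp_phi i : compact (phi i) by rewrite (pP i).2; exact: compact_homothet.
have phi0 i : phi i !=set0.
  rewrite (pP i).2; case: K0 => x Kx.
  by exists ((p i).1 + (p i).2 *: x), x.
have suppE i u : supp (phi i) u = dot u (p i).1 + (p i).2 * supp K u.
  by rewrite (pP i).2 supp_homothet//; exact: (pP i).1.
have finD (D : set (ground n)) : finite_set D.
  apply: (@sub_finite_set _ _ ([set a0; a1] `|` range (@g n))).
    by move=> [||i] _; [left; left|left; right|right; exists i].
  by rewrite finite_setU; split; [exact: finite_set2|exact: finite_image].
(* The set D is closed for tau, since g k is not in D, and a is not in D. *)
have dir a b k : a <> b -> (forall i, a <> g i) -> (forall i, b <> g i) ->
    exists u, [/\ supp (phi b) u < supp (phi a) u,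
      forall i, i != k -> supp (phi (g i)) u < supp (phi a) u &
      supp (phi a) u <= supp (phi (g k)) u].
  move=> ab nag nbg; pose D := [set i | i <> a /\ i <> g k].
  have [||u uP] := @nsub_hull_supp R 2 _ D phi (phi a) (finD D) _
    conv_phi comp_phi phi0 (comp_phi a).
  - by exists b; split; [exact/nesym|exact: nbg].
  - move=> /phiP/tau_funE[gD|[]//].
    by have [] := gD (g k) (ex_intro2 _ _ k I erefl).
  have lt i : i != k -> supp (phi (g i)) u < supp (phi a) u.
    move=> /eqP ik; apply: uP; split; first exact/nesym/nag.
    by move=> [].
  exists u; split => //.
    by apply: uP; split; [exact/nesym|exact: nbg].
  have [|_ [i _ <-]] := @sub_hull_supp R 2 _ (range (@g n)) phi (phi a) u
    comp_phi phi0 (comp_phi a) (phi0 a).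
    by apply/phiP/tau_funE; left.
  have [->//|/lt ik] := eqVneq i k.
  by rewrite leNgt ik.
have main a b : a <> b -> (forall i, a <> g i) -> (forall i, b <> g i) ->
    (p a).2 <= (p b).2 -> False.
  move=> ab nag nbg pab.
  have /choice[U UP] := fun k => dir a b k ab nag nbg.
  have /choice[V VP] := fun k => dir b a k (nesym ab) nbg nag.
  have mid i j k c d : i != j -> k != j -> 0 <= c -> 0 <= d ->
      U j != c *: U i + d *: U k.
    move=> ij kj c0 d0; have ji : j != i by rewrite eq_sym.
    have jk : j != k by rewrite eq_sym.
    have [Ui Ui' _] := UP i; have [Uk Uk' _] := UP k; have [Uj _ Uj'] := UP j.
    have [Vj _ Vj'] := VP j.
    have := @no_alternating_homothets R K compK K_int (p a).1 (p b).1 (p (g j)).1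
      (p a).2 (p b).2 (p (g j)).2 (U i) (U j) (U k) (V j) c d.
    rewrite /= -!suppE; apply=> //; [exact: Ui'|exact: Uk'].
  pose i0 : 'I_n := Ordinal (ltn_trans (isT : 0 < 2)%N n3).
  pose i1 : 'I_n := Ordinal (ltn_trans (isT : 1 < 2)%N n3).
  pose i2 : 'I_n := Ordinal n3.
  have f_sl : superlinear (fun u => dot u ((p a).1 - (p b).1) +
      ((p a).2 - (p b).2) * supp K u).
    by apply: superlinear_supp_diff => //; rewrite subr_le0.
  have f_gt0 k : 0 < dot (U k) ((p a).1 - (p b).1) +
      ((p a).2 - (p b).2) * supp K (U k).
    have [] := UP k; rewrite !suppE dotDr dotNr => + _ _; lra.
  have [c [d [c0 d0]]] := positive_middle f_sl (f_gt0 i0) (f_gt0 i1) (f_gt0 i2).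
  by case=> /eqP; apply/negP; apply: mid.
have [le|le] := leP (p a0).2 (p a1).2.
  exact: main le.
exact: main (ltW le).
Qed.
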